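(* Let $n \ge 2$, let $A^{(n)}=\{a_1,\ldots,a_n\}$ be a set with $n$ elements and let $G=G_{A^{(n)}}$ be its set-graph. If $v_{s,i}$ and $v_{s,j}$ are vertices of $G$ corresponding to non-empty subsets $A^{(n)}_{s,i}$ and $A^{(n)}_{s,j}$ of $A^{(n)}$ of equal cardinality $s$, then $d_G(v_{s,i}) = d_G(v_{s,j})$.
   Context: For a set $A^{(n)}=\{a_1,\ldots,a_n\}$ of $n$ distinct elements, let $A^{(n)}_{s,i}$, $1\le s\le n$, $1 \le i \le \binom{n}{s}$, denote the $i$-th $s$-element subset of $A^{(n)}$ in some fixed enumeration. The set-graph $G_{A^{(n)}}$ is the simple undirected graph with one vertex $v_{s,i}$ for each non-empty subset $A^{(n)}_{s,i}$, two distinct vertices $v_{s,i}, v_{t,j}$ being adjacent if and only if $A^{(n)}_{s,i}\cap A^{(n)}_{t,j}\neq\emptyset$. $d_G(v)$ denotes the degree of $v$ in $G$. *)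

(* Defs.v *)
From mathcomp Require Import all_boot.
Set Implicit Arguments.
Unset Strict Implicit.
Unset Printing Implicit Defensive.

Record sgraph := SGraph {
  vertex :> finType;
  adj : rel vertex;
  adj_sym : symmetric adj;
  adj_irrefl : irreflexive adj }.

Definition deg (G : sgraph) (v : G) : nat := #|[set w : G | adj v w]|.

Section SetGraph.
Variable A : finType.

(* The paper's v_{s,i} is the subset A_{s,i} itself, so that s = #|val v| and
   the index i only distinguishes the subsets of cardinality s. *)
Definition nonempty_subset : finType := {X : {set A} | X != set0}.

Definition set_adj (u v : nonempty_subset) : bool :=
  (u != v) && (val u :&: val v != set0).

Lemma set_adj_sym : symmetric set_adj.
Proof. by move=> u v; rewrite /set_adj eq_sym setIC. Qed.

Lemma set_adj_irrefl : irreflexive set_adj.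
Proof. by move=> u; rewrite /set_adj eqxx. Qed.

Definition set_graph : sgraph := SGraph set_adj_sym set_adj_irrefl.

Definition subset_of (v : set_graph) : {set A} := val (v : nonempty_subset).

End SetGraph.

(* Main.v *)
(* A non-empty set X meets every subset except the 2^(n - |X|) subsets of its
   complement; excluding X itself, its degree depends on |X| only. *)
Require Import Defs.
From mathcomp Require Import all_boot.

(** The degree has a closed form in [#|A|] and the size of the subset: count the sets meeting [u] by
    complement, then discard [u]. Equal sizes thus give equal degrees. *)

Lemma deg_set_graph (A : finType) (u : set_graph A) :
  deg u = (2 ^ #|A| - 2 ^ (#|A| - #|subset_of u|)).-1.
Proof.
have u0 : subset_of u != set0 := valP (u : nonempty_subset A).
pose M := ~: powerset (~: subset_of u).
have inM X : (X \in M) = (subset_of u :&: X != set0).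
  by rewrite !inE -disjoints_subset -setI_eq0 setIC.
(* Neighbours can be counted among all sets: one that meets [u] is non-empty, hence a vertex. *)
have -> : deg u = #|M :\ subset_of u|.
  rewrite /deg -(card_imset _ (val_inj : injective (@subset_of A))).
  congr #|pred_of_set _|; apply/setP => X; rewrite in_setD1 inM.
  apply/imsetP/andP => [[w] | [neqX meetX]].
    rewrite inE => /andP[neq_uw meet_uw] ->; split=> //.
    by rewrite eq_sym.
  have X0 : X != set0 by apply: contraNneq meetX => ->; rewrite setI0.
  exists (Sub X X0 : nonempty_subset A); last by rewrite /subset_of SubK.
  by rewrite inE /= /set_adj SubK meetX andbT -val_eqE SubK eq_sym.
(* Being non-empty, [u] meets itself, so discarding it costs exactly one: the [.-1]. *)
have uM : subset_of u \in M by rewrite inM setIid.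
have -> : #|M :\ subset_of u| = #|M|.-1 by rewrite (cardsD1 (subset_of u) M) uM.
by rewrite [#|M|]cardsCs setCK card_powerset [#|~: _|]cardsCs setCK -cardsT -powersetT card_powerset cardsT.
Qed.

Theorem theorem2p3 (n : nat) (hn : 2 <= n) (A : finType) (hA : #|A| = n)
    (s : nat) (u v : set_graph A)
    (hu : #|subset_of u| = s) (hv : #|subset_of v| = s) :
  deg u = deg v.
Proof. by rewrite !deg_set_graph hu hv. Qed.
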